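(* There exist $b_1,b_2\in L^\infty_{loc}(\mathbb{R})$ such that $S_2(b_1,b_2)+T_2(b_1,b_2)<\infty$, but $S_{A,B}(b_1,b_2)=\infty$ and $T_C(b_1,b_2)=\infty$ for all Young functions $A,B,C$ with $\bar A,\bar B,\bar C\in B_2$. Moreover, the commutator $C_bH=[b_2,[b_1,H]]$ is not bounded on $L^2(\mathbb{R})$.
   Context: $H$ is the Hilbert transform $Hf(x)=\lim_{\varepsilon\to0}\int_{|x-y|>\varepsilon}\frac{f(y)}{x-y}dy$; $[A,B]=AB-BA$ with $b_i$ acting by multiplication. A Young function is a continuous, convex, strictly increasing $A:[0,\infty)\to[0,\infty)$ with $A(0)=0$ and $A(t)/t\to\infty$; $\bar A(t)=\sup_{s>0}\{st-A(s)\}$; $A\in B_2$ means $\int_1^\infty\frac{A(t)}{t^2}\frac{dt}{t}<\infty$; $\langle|f|\rangle_{A,I}=\inf\{\lambda>0:\frac1{|I|}\int_IA(|f|/\lambda)\le1\}$. With $\langle g\rangle_I=\frac1{|I|}\int_Ig$ and suprema over all intervals $I\subset\mathbb{R}$: $S_2(b_1,b_2)=\sup_I\big(\frac1{|I|}\int_I|b_1-\langle b_1\rangle_I|^2\big)^{1/2}\big(\frac1{|I|}\int_I|b_2-\langle b_2\rangle_I|^2\big)^{1/2}$, $T_2(b_1,b_2)=\sup_I\big(\frac1{|I|}\int_I|b_1-\langle b_1\rangle_I|^2|b_2-\langle b_2\rangle_I|^2\big)^{1/2}$, $S_{A,B}(b_1,b_2)=\sup_I\langle|b_1-\langle b_1\rangle_I|\rangle_{A,I}\langle|b_2-\langle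 b_2\rangle_I|\rangle_{B,I}$, $T_C(b_1,b_2)=\sup_I\langle|b_1-\langle b_1\rangle_I||b_2-\langle b_2\rangle_I|\rangle_{C,I}$. *)

(* Defs.v *)
From HB Require Import structures.
From mathcomp Require Import all_boot all_order all_algebra.
From mathcomp Require Import all_classical all_reals all_analysis.
Set Implicit Arguments. Unset Strict Implicit. Unset Printing Implicit Defensive.
Import Order.TTheory GRing.Theory Num.Theory.
Import numFieldNormedType.Exports.
Local Open Scope classical_set_scope.
Local Open Scope ring_scope.

(* Conventions: the real line is an arbitrary [R : realType] (i.e. the reals),
   with Lebesgue measure [lebesgue_measure]. "Intervals" are the bounded
   nondegenerate intervals [a, c] with a < c (open/closed is irrelevant for
   the averages below). *)

Section Defs.
Context {R : realType}.
Local Notation mu := (@lebesgue_measure R).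

Definition Linfty_loc (b : R -> R) : Prop :=
  measurable_fun [set: R] b /\
  forall a c : R, exists M : R,
    {ae mu, forall x, a <= x <= c -> `|b x| <= M}.

Definition avg (g : R -> R) (a c : R) : R :=
  (c - a)^-1 * Rintegral mu `[a, c] g.

Definition osc2 (b : R -> R) (a c : R) : \bar R :=
  (((c - a)^-1)%:E *
    \int[mu]_(x in `[a, c]) ((`|b x - avg b a c| ^+ 2)%:E)) `^ (2^-1).

Definition osc2prod (b1 b2 : R -> R) (a c : R) : \bar R :=
  (((c - a)^-1)%:E *
    \int[mu]_(x in `[a, c]) ((`|b1 x - avg b1 a c| ^+ 2 *
                             `|b2 x - avg b2 a c| ^+ 2)%:E)) `^ (2^-1).

(* Luxemburg average <g>_{A,I} = inf { l > 0 : 1/|I| int_I A(g/l) <= 1 },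
   applied to nonnegative g (g = |f|) *)
Definition lux (A : R -> R) (g : R -> R) (a c : R) : \bar R :=
  ereal_inf [set l%:E | l in [set l : R | 0 < l /\
     (((c - a)^-1)%:E * \int[mu]_(x in `[a, c]) (A (g x / l))%:E <= 1)%E]].

Definition sup_intervals (F : R -> R -> \bar R) : \bar R :=
  ereal_sup [set y | exists a c : R, a < c /\ y = F a c].

Definition S2 (b1 b2 : R -> R) : \bar R :=
  sup_intervals (fun a c => (osc2 b1 a c * osc2 b2 a c)%E).

Definition T2 (b1 b2 : R -> R) : \bar R :=
  sup_intervals (osc2prod b1 b2).

Definition SAB (A B : R -> R) (b1 b2 : R -> R) : \bar R :=
  sup_intervals (fun a c =>
    (lux A (fun x => `|b1 x - avg b1 a c|%R) a c *
     lux B (fun x => `|b2 x - avg b2 a c|%R) a c)%E).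

Definition TC (C : R -> R) (b1 b2 : R -> R) : \bar R :=
  sup_intervals (fun a c =>
    lux C (fun x => `|b1 x - avg b1 a c| * `|b2 x - avg b2 a c|) a c).

(* Young function A : [0,oo) -> [0,oo) (values on negative reals irrelevant) *)
Definition young (A : R -> R) : Prop :=
  [/\ {within `[0, +oo[, continuous A},
      (forall s t l : R, 0 <= s -> 0 <= t -> 0 <= l <= 1 ->
          A (l * s + (1 - l) * t) <= l * A s + (1 - l) * A t),
      (forall s t : R, 0 <= s -> s < t -> A s < A t),
      A 0 = 0 &
      (A t / t) @[t --> +oo] --> +oo].

Definition young_conj (A : R -> R) (t : R) : \bar R :=
  ereal_sup [set (s * t - A s)%:E | s in `]0, +oo[].

(* B_2 condition: int_1^oo phi(t)/t^2 dt/t < oo *)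
Definition B2 (phi : R -> \bar R) : Prop :=
  (\int[mu]_(t in `[1%R, +oo[%classic) (phi t * (t ^- 3)%:E) < +oo)%E.

Definition hilbert (f : R -> R) (x : R) : R :=
  lim ((fun eps => Rintegral mu [set y | eps < `|x - y|] (fun y => f y / (x - y)))
         @ 0^'+).

Definition commut (b : R -> R) (T : (R -> R) -> R -> R) (f : R -> R) : R -> R :=
  fun x => b x * T f x - T (fun y => b y * f y) x.

Definition CbH (b1 b2 : R -> R) : (R -> R) -> R -> R :=
  commut b2 (commut b1 hilbert).

Definition L2norm (f : R -> R) : \bar R := ('N[mu]_(2%:E) [EFin \o f])%E.

Definition test_fun (f : R -> R) : Prop :=
  [/\ measurable_fun [set: R] f,
      (exists K : R, forall x, `|f x| <= K) &
      (exists a c : R, forall x, ~ (a <= x <= c) -> f x = 0)].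

(* T bounded on L^2(R) (on the dense class of test functions) *)
Definition L2_bounded (T : (R -> R) -> R -> R) : Prop :=
  exists M : R, forall f, test_fun f -> (L2norm (T f) <= M%:E * L2norm f)%E.

End Defs.

(* Main.v *)
(* Take [b1 x = sqrt x] for [x >= 0], extended by 0, and [b2] the indicator of
   [[-1, 0]].  On [[a, c]] with [a <= 0 < c] the function [b1] is at most
   [sqrt c] while [b2] has mass at most 1, so every quadratic quantity is bounded
   by a constant times [c / (c - a) <= 1].
   On [[-u^2, u^2]], however, [b1] deviates from its mean by a multiple of [u] on
   a fixed proportion of the interval, and [b2] by a constant on a proportion
   [1 / (2 u^2)].  A Young function whose conjugate is in [B2] grows strictly
   faster than [t^2], and such a spike has unbounded normalised Luxemburg norm.
   Finally, the commutator maps [b2] to [x |-> - sqrt x * H b2 x] on [x > 0],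
   where [H b2 x >= 1 / (1 + x)]; the square of this is not integrable at
   infinity. *)
Require Import Defs.
From HB Require Import structures.
From mathcomp Require Import all_boot all_order all_algebra.
From mathcomp Require Import all_classical all_reals all_analysis.
From mathcomp Require Import measurable_realfun ring lra.
Set Implicit Arguments.
Unset Strict Implicit.
Unset Printing Implicit Defensive.
Import Order.TTheory GRing.Theory Num.Theory.
Import numFieldNormedType.Exports.
Local Open Scope classical_set_scope.
Local Open Scope ring_scope.

(** * Comparison of integrals of nonnegative functions that need not be measurable *)

Section nonmeasurable_integrands.
Context {d : measure_display} {T : measurableType d} {R : realType}.
Context (mu : {measure set T -> \bar R}).

(** The integral of a nonnegative function is a supremum over the simple functions below it, and
    every simple function below [f] is below [g]. This spares measurability proofs for conjugates
    and for compositions with Young functions. *)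
Lemma nonneg_le_integral (D : set T) (f g : T -> \bar R) :
  (forall x, D x -> (0 <= f x)%E) -> (forall x, D x -> (f x <= g x)%E) ->
  (\int[mu]_(x in D) f x <= \int[mu]_(x in D) g x)%E.
Proof.
move=> f0 fg; have g0 x : D x -> (0 <= g x)%E.
  by move=> Dx; exact: le_trans (f0 x Dx) (fg x Dx).
rewrite !ge0_integralE//; apply: ereal_sup_le => _ [h hf <-].
exists h => // x; apply: le_trans (hf x) _.
exact: lee_restrict.
Qed.

Lemma nonneg_integral_ge_cst (D E : set T) (g : T -> \bar R) (k : R) :
  measurable E -> E `<=` D -> 0 <= k -> (forall x, D x -> (0 <= g x)%E) ->
  (forall x, E x -> (k%:E <= g x)%E) ->
  (k%:E * mu E <= \int[mu]_(x in D) g x)%E.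
Proof.
move=> mE ED k0 g0 kg.
rewrite -(integral_cst _ mE) integral_mkcond (integral_mkcond D).
apply: nonneg_le_integral => x _; rewrite !patchE.
  by case: ifP => // _; rewrite lee_fin.
case: ifPn => [/set_mem Ex|_]; first by rewrite mem_set ?kg//; exact: ED.
by case: ifPn => // /set_mem /g0.
Qed.

Lemma nonneg_integral_le_cst (D : set T) (g : T -> \bar R) (k : \bar R) :
  measurable D -> (forall x, D x -> (0 <= g x <= k)%E) ->
  (\int[mu]_(x in D) g x <= k * mu D)%E.
Proof.
move=> mD gk; rewrite -(integral_cst _ mD).
by apply: nonneg_le_integral => x /gk /andP[].
Qed.

End nonmeasurable_integrands.

(** * Growth of Young functions, and lower bounds for Luxemburg and ordinary averages *)

Section young_functions_and_averages.
Context {R : realType}.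
Local Notation mu := (@lebesgue_measure R).

Lemma young_conj_ge (A : R -> R) (s t : R) : 0 < s ->
  ((s * t - A s)%:E <= young_conj A t)%E.
Proof.
by move=> s0; apply: ereal_sup_ubound; exists s => //=; rewrite in_itv/= s0.
Qed.

Lemma young_ge0 (A : R -> R) (t : R) : young A -> 0 <= t -> 0 <= A t.
Proof.
move=> [_ _ Ai A0 _]; rewrite le_eqVlt => /predU1P[<-|t0]; first by rewrite A0.
by rewrite -A0 ltW// Ai.
Qed.

Lemma young_le (A : R -> R) (s t : R) : young A -> 0 <= s -> s <= t -> A s <= A t.
Proof.
move=> [_ _ Ai A0 _] s0; rewrite le_eqVlt => /predU1P[<-//|st].
by rewrite ltW// Ai.
Qed.

Lemma young_unbounded (A : R -> R) (M : R) : young A -> exists2 t, 0 < t & M < A t.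
Proof.
move=> [_ _ _ _ /cvgryPgt/(_ (`|M|)) [T [_ At]]].
pose t := `|T| + 1; have t1 : 1 <= t by rewrite lerDr.
have : `|M| < A t / t by apply: At; rewrite /t (le_lt_trans (ler_norm T))// ltrDl.
rewrite ltr_pdivlMr ?(lt_le_trans _ t1)// => MA.
exists t; first exact: lt_le_trans t1.
apply: le_lt_trans MA; rewrite (le_trans (ler_norm M))//.
by rewrite ler_peMr.
Qed.

(** The supremum excludes [s = 0], so the value 0 is only approached: convexity gives
    [A l <= l * A 1], hence the conjugate is at least [l * (t - A 1)] for every [l] in []0, 1]]. *)
Lemma young_conj_ge0 (A : R -> R) (t : R) : young A -> (0 <= young_conj A t)%E.
Proof.
move=> [_ Ac _ A0 _].
have H l : 0 < l -> l <= 1 -> ((l * (t - A 1))%:E <= young_conj A t)%E.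
  move=> l0 l1; apply: le_trans (@young_conj_ge A l t l0).
  have := Ac 1 0 l ler01 (lexx 0).
  rewrite mulr1 mulr0 addr0 A0 mulr0 addr0 (ltW l0) l1 => /(_ erefl) h.
  by rewrite lee_fin mulrBr lerB.
have [q0|q0] := leP (A 1) t.
  apply: le_trans (H 1 ltr01 (lexx _)).
  by rewrite lee_fin mul1r subr_ge0.
case E : (young_conj A t) => [r|//|]; last first.
  by have := H 1 ltr01 (lexx _); rewrite E.
rewrite lee_fin leNgt; apply/negP => r0.
have := H 1 ltr01 (lexx _); rewrite E lee_fin mul1r => rq.
have q : 0 < A 1 - t by lra.
(* This [l] makes the lower bound equal to [r / 2], which exceeds the negative [r]; it is at most 1
   because [t - A 1 <= r]. *)
have := H (- r / (2 * (A 1 - t))) _ _; rewrite E.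
have -> : - r / (2 * (A 1 - t)) * (t - A 1) = r / 2 by field; rewrite gt_eqF.
rewrite lee_fin => h; suff : r / 2 <= r by lra.
apply: h; first by rewrite divr_gt0//; lra.
by rewrite ler_pdivrMr; lra.
Qed.

(** Each window contributes at least [delta], and successive windows can be taken disjoint, since
    the next one may start past the end of the last. *)
Lemma integral_windows_pinfty (g : R -> \bar R) (a delta : R) : 0 < delta ->
  (forall x, a <= x -> (0 <= g x)%E) ->
  (forall T, a <= T -> exists p q k, [/\ T <= p, p < q, 0 <= k,
     delta <= k * (q - p) & forall x, p <= x < q -> (k%:E <= g x)%E]) ->
  (\int[mu]_(x in `[a, +oo[) g x)%E = +oo%E.
Proof.
move=> d0 g0 win.
(* The windows are collected in a measurable step function [h] below [g], for which additivity of
   the integral is available. The starting point [T] is universally quantified so that the induction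
   can restart at [q]. *)
have key n : forall T, a <= T -> exists h : R -> R,
    [/\ measurable_fun [set: R] h, (forall x, 0 <= h x),
        (forall x, x < T -> h x = 0),
        (forall x, T <= x -> ((h x)%:E <= g x)%E) &
        ((n%:R * delta)%:E <= \int[mu]_x (h x)%:E)%E].
  elim: n => [|n IH] T aT.
    exists (cst 0); split => //.
      by move=> x Tx; apply: g0; exact: le_trans Tx.
    by rewrite integral0 mul0r.
  have [p [q [k [Tp pq k0 kd kg]]]] := win T aT.
  have [|h [mh h0 hq hg hn]] := IH q; first lra.
  pose E := `[p, q[%classic : set R.
  exists (fun x => h x + k * \1_E x).
  have mE : measurable_fun [set: R] (fun x => k * \1_E x).
    by apply: measurable_funM => //; apply: measurable_indic; exact: measurable_itv.
  have E0 x : 0 <= k * \1_E x by rewrite mulr_ge0// indicE.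
  have EN x : ~~ (p <= x < q) -> k * \1_E x = 0.
    by move=> xE; rewrite indicE memNset ?mulr0// /E/= in_itv/=; exact/negP.
  split.
  - exact: measurable_funD.
  - by move=> x; rewrite addr_ge0.
  - by move=> x xT; rewrite hq ?EN ?add0r//; lra.
  - move=> x Tx; have [xq|qx] := ltP x q; last first.
      by rewrite EN ?addr0; [exact: hg|lra].
    rewrite hq// add0r; have [xp|px] := ltP x p.
      by rewrite EN ?g0//; lra.
    rewrite indicE mem_set/= ?mulr1 ?kg ?px//.
    by rewrite /E/= in_itv/= px.
  - under eq_integral do rewrite EFinD.
    rewrite ge0_integralD//=.
    + rewrite -natr1 mulrDl mul1r EFinD; apply: leeD => //.
      apply: (@le_trans _ _ (k%:E * mu E)%E).
        by rewrite lebesgue_measure_itv/= lte_fin pq -EFinB -EFinM lee_fin.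
      apply: nonneg_integral_ge_cst => //; first exact: measurable_itv.
        by move=> x _; rewrite lee_fin.
      by move=> x Ex; rewrite indicE mem_set// mulr1.
    + by move=> x _; rewrite lee_fin.
    + exact/measurable_EFinP.
    + by move=> x _; rewrite lee_fin.
    + exact/measurable_EFinP.
apply/eqyP => r r0.
have [h [_ h0 ha hg hn]] := key (Num.truncn (r / delta)).+1 a (lexx _).
apply: le_trans (le_trans hn _).
  by rewrite lee_fin -ler_pdivrMr// ltW// truncnS_gt.
rewrite [leRHS]integral_mkcond.
apply: nonneg_le_integral => x _; first by rewrite lee_fin.
rewrite patchE; case: ifPn => [/set_mem|]; rewrite /= ?in_itv/= ?andbT.
  exact: hg.
by rewrite notin_setE/= in_itv/= andbT => /negP; rewrite -ltNge => /ha ->.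
Qed.

(* If [A s < M s^2], testing the supremum at [s] gives [conj A >= M s^2] on
   [[2Ms, 4Ms[], a window contributing [1/(32M)] to the [B2] integral. *)
Lemma B2_conj_quadratic_growth (A : R -> R) (M : R) : young A ->
  B2 (young_conj A) -> 0 < M ->
  exists2 T, 0 < T & forall t, T <= t -> M * t ^+ 2 <= A t.
Proof.
move=> yA B2A M0; apply: contrapT => nT.
have {}nT (T : R) : 0 < T -> exists2 s, T <= s & A s < M * s ^+ 2.
  move=> T0; apply: contrapT => ns; apply: nT; exists T => // t Tt.
  by rewrite leNgt; apply/negP => At; apply: ns; exists t.
move: B2A; rewrite /B2 (@integral_windows_pinfty _ 1 (32 * M)^-1)//.
- by rewrite invr_gt0; lra.
- move=> t t1; rewrite mule_ge0// ?young_conj_ge0// lee_fin invr_ge0 exprn_ge0//.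
  lra.
- move=> T T1; have [|s Ts As] := nT (T / (2 * M)).
    by rewrite divr_gt0//; lra.
  have s0 : 0 < s by apply: lt_le_trans Ts; rewrite divr_gt0//; lra.
  have Ms0 : 0 < M * s by rewrite mulr_gt0.
  (* The level combines the bound [M * s ^+ 2] on the conjugate with the value of [t ^- 3] at the
     right end; [s >= T / (2 * M)] puts the window past [T]. *)
  exists (2 * M * s), (4 * M * s), (M * s ^+ 2 / (4 * M * s) ^+ 3); split.
  + by rewrite mulrC -ler_pdivrMr//; lra.
  + lra.
  + by rewrite divr_ge0 ?mulr_ge0 ?exprn_ge0//; lra.
  + by rewrite le_eqVlt; apply/orP; left; apply/eqP; field; rewrite !gt_eqF.
  + move=> x /andP[sx xs]; rewrite EFinM; apply: lee_pmul.
    * by rewrite lee_fin mulr_ge0 ?exprn_ge0//; lra.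
    * by rewrite lee_fin invr_ge0 exprn_ge0//; lra.
    * apply: le_trans (@young_conj_ge A s x s0); rewrite lee_fin.
      have : s * (2 * M * s) <= s * x by rewrite ler_pM2l.
      nra.
    * rewrite lee_fin lef_pV2 ?posrE ?exprn_gt0//; [|lra|lra].
      by rewrite lerXn2r// ?nnegrE//; lra.
Qed.

(** An admissible [l < K] would make [A (g / l)] at least [A (h / K)] on [[p, q]], so its average
    over [[a, c]] would exceed 1. *)
Lemma lux_ge (A g : R -> R) (a c p q h K : R) : young A -> a < c ->
  a <= p -> p < q -> q <= c -> 0 <= h -> 0 < K ->
  (forall x, a <= x <= c -> 0 <= g x) -> (forall x, p <= x <= q -> h <= g x) ->
  c - a < A (h / K) * (q - p) -> (K%:E <= lux A g a c)%E.
Proof.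
move=> yA ac ap pq qc h0 K0 g0 hg AK; apply: le_ereal_inf_tmp => _ [l [l0 hl] <-].
rewrite lee_fin leNgt; apply/negP => lK; move: hl; apply/negP; rewrite -ltNge.
have Ahl : A (h / K) <= A (h / l).
  apply: young_le => //; first by rewrite divr_ge0// ltW.
  by rewrite ler_wpM2l// lef_pV2// ltW.
have h1 : ((A (h / l))%:E * mu `[p, q]%classic <=
    \int[mu]_(x in `[a, c]) (A (g x / l))%:E)%E.
  apply: nonneg_integral_ge_cst.
  - exact: measurable_itv.
  - by apply: subset_itv; rewrite bnd_simp.
  - by apply: young_ge0 => //; rewrite divr_ge0// ltW.
  - move=> x /=; rewrite in_itv/= => xac; rewrite lee_fin young_ge0//.
    by rewrite divr_ge0 ?g0// ltW.
  - move=> x /=; rewrite in_itv/= => xpq; rewrite lee_fin young_le//.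
      by rewrite divr_ge0// ltW.
    by rewrite ler_pM2r ?invr_gt0// hg.
apply: lt_le_trans (_ : (((c - a)^-1)%:E * ((A (h / l))%:E * mu `[p, q]%classic) <= _)%E).
  rewrite lebesgue_measure_itv/= lte_fin pq -EFinB -!EFinM lte_fin.
  rewrite mulrC ltr_pdivlMr ?subr_gt0// mul1r (lt_le_trans AK)//.
  by rewrite ler_pM2r// subr_gt0.
apply: lee_pmul => //; first by rewrite lee_fin invr_ge0 subr_ge0 ltW.
by rewrite mule_ge0// lee_fin young_ge0// divr_ge0// ltW.
Qed.

Lemma avg_ge0_le (g : R -> R) (a c K : R) : a < c ->
  (forall x, a <= x <= c -> 0 <= g x <= K) -> 0 <= avg g a c <= K.
Proof.
move=> ac gK; have ca : 0 < c - a by rewrite subr_gt0.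
have I0 : (0 <= \int[mu]_(x in `[a, c]) (g x)%:E)%E.
  apply: integral_ge0 => x /=; rewrite in_itv/= => /gK /andP[+ _].
  by rewrite lee_fin.
have IK : (\int[mu]_(x in `[a, c]) (g x)%:E <= (K * (c - a))%:E)%E.
  rewrite EFinM; have <- : mu `[a, c]%classic = (c - a)%:E.
    by rewrite lebesgue_measure_itv/= lte_fin ac -EFinB.
  apply: nonneg_integral_le_cst; first exact: measurable_itv.
  by move=> x /=; rewrite in_itv/= => /gK; rewrite !lee_fin.
rewrite /avg /Rintegral mulrC; apply/andP; split.
  by rewrite divr_ge0 ?fine_ge0// ltW.
rewrite ler_pdivrMr// -lee_fin fineK//.
by rewrite ge0_fin_numE// (le_lt_trans IK)// ltry.
Qed.

(** The bound [K] keeps the integral finite: [fine] sends [+oo] to 0, which would destroy a lower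
    bound. *)
Lemma avg_ge (g : R -> R) (a c p q h K : R) : a < c -> a <= p -> p < q ->
  q <= c -> 0 <= h -> (forall x, a <= x <= c -> 0 <= g x <= K) ->
  (forall x, p <= x <= q -> h <= g x) -> h * (q - p) / (c - a) <= avg g a c.
Proof.
move=> ac ap pq qc h0 gK hg; have ca : 0 < c - a by rewrite subr_gt0.
have g0 x : `[a, c]%classic x -> (0 <= (g x)%:E)%E.
  by rewrite /= in_itv/= => /gK /andP[+ _]; rewrite lee_fin.
have I0 : (0 <= \int[mu]_(x in `[a, c]) (g x)%:E)%E by exact: integral_ge0.
have IK : (\int[mu]_(x in `[a, c]) (g x)%:E < +oo)%E.
  apply: (@le_lt_trans _ _ (K%:E * mu `[a, c]%classic)%E); last first.
    by rewrite lebesgue_measure_itv/= lte_fin ac -EFinB -EFinM ltry.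
  apply: nonneg_integral_le_cst; first exact: measurable_itv.
  by move=> x /=; rewrite in_itv/= => /gK; rewrite !lee_fin.
rewrite /avg /Rintegral mulrC ler_pM2l ?invr_gt0//.
rewrite -lee_fin fineK ?ge0_fin_numE//.
rewrite EFinM; have <- : mu `[p, q]%classic = (q - p)%:E.
  by rewrite lebesgue_measure_itv/= lte_fin pq -EFinB.
apply: nonneg_integral_ge_cst => //.
by apply: subset_itv; rewrite bnd_simp.
Qed.

End young_functions_and_averages.

Lemma poweR_half_homo (R : realType) (x y : \bar R) :
  (0 <= x)%E -> (x <= y)%E -> (x `^ 2^-1 <= y `^ 2^-1)%E.
Proof.
move=> x0 xy; apply: gt0_ler_poweR => //.
  by rewrite in_itv/= x0 leey.
by rewrite in_itv/= (le_trans x0 xy) leey.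
Qed.

(** * The pair of functions and the upper bounds on its quadratic oscillations *)

Section example.
Context {R : realType}.
Local Notation mu := (@lebesgue_measure R).
(** [Num.sqrt] is 0 on negative reals, so it already is the extension by zero. *)
Local Notation b1 := (@Num.sqrt R).

Definition unit_bump : R -> R := \1_(`[-1, 0]%classic : set R).
Local Notation b2 := unit_bump.

Lemma unit_bump_in (x : R) : -1 <= x <= 0 -> b2 x = 1.
Proof. by move=> h; rewrite /b2 indicE mem_set//= in_itv. Qed.

Lemma unit_bump_out (x : R) : ~~ (-1 <= x <= 0) -> b2 x = 0.
Proof.
by move=> h; rewrite /b2 indicE memNset//= in_itv/=; exact/negP.
Qed.

Lemma unit_bump_ge0_le1 (x : R) : 0 <= b2 x <= 1.
Proof. by rewrite /b2 indicE; case: (_ \in _) => /=; rewrite ?lexx ler01. Qed.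

Lemma Linfty_loc_sqrt : Linfty_loc b1.
Proof.
split; first by apply: continuous_measurable_fun; exact: sqrt_continuous.
move=> a c; exists (b1 c); apply: aeW => x /andP[_ xc].
by rewrite ger0_norm ?sqrtr_ge0// ler_wsqrtr.
Qed.

Lemma Linfty_loc_unit_bump : Linfty_loc b2.
Proof.
split; first by apply: measurable_indic; exact: measurable_itv.
move=> a c; exists 1; apply: aeW => x _.
by have /andP[? ?] := unit_bump_ge0_le1 x; rewrite ger0_norm.
Qed.

Lemma sqrt_avg_dist (a c x : R) : a < c -> a <= x <= c ->
  `|b1 x - avg b1 a c| <= b1 c.
Proof.
move=> ac /andP[ax xc].
have /andP[m0 mc] : 0 <= avg b1 a c <= b1 c.
  by apply: avg_ge0_le => // y /andP[_ yc]; rewrite sqrtr_ge0 ler_wsqrtr.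
have := sqrtr_ge0 x; have : b1 x <= b1 c by rewrite ler_wsqrtr.
by rewrite ler_norml; lra.
Qed.

Lemma unit_bump_avg_ge0_le1 (a c : R) : a < c -> 0 <= avg b2 a c <= 1.
Proof. by move=> ac; apply: avg_ge0_le => // x _; exact: unit_bump_ge0_le1. Qed.

(** For [v] and [m] in [[0, 1]], [(v - m)^2 <= v^2 + m^2 <= v + m]. The right-hand side is linear in
    [b2], so it integrates to twice the mass of [b2] on the interval. *)
Lemma unit_bump_avg_dist (a c x : R) : a < c ->
  `|b2 x - avg b2 a c| ^+ 2 <= b2 x + avg b2 a c.
Proof.
move=> ac; have /andP[m0 m1] := unit_bump_avg_ge0_le1 ac.
have /andP[x0 x1] := unit_bump_ge0_le1 x.
rewrite real_normK ?num_real//; nra.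
Qed.

Lemma integral_unit_bump (a c : R) :
  (\int[mu]_(x in `[a, c]) (b2 x)%:E)%E = mu (`[-1, 0]%classic `&` `[a, c]%classic).
Proof. by rewrite integral_indic//; exact: measurable_itv. Qed.

Lemma integral_unit_bump_le1 (a c : R) :
  (\int[mu]_(x in `[a, c]) (b2 x)%:E <= 1)%E.
Proof.
rewrite integral_unit_bump.
apply: (@le_trans _ _ (mu `[-1, 0]%classic)).
  by apply: le_measure; rewrite ?inE;
    [apply: measurableI; exact: measurable_itv|exact: measurable_itv|exact: subIsetl].
by rewrite lebesgue_measure_itv/= lte_fin ltrN10 -EFinB lee_fin; lra.
Qed.

Lemma avg_unit_bump (a c : R) : a < c ->
  [/\ (\int[mu]_(x in `[a, c]) (b2 x)%:E)%E = ((c - a) * avg b2 a c)%:E,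
      (c - a) * avg b2 a c <= 1 & 0 < a -> avg b2 a c = 0].
Proof.
move=> ac; have ca : c - a != 0 by rewrite gt_eqF// subr_gt0.
have fin : (\int[mu]_(x in `[a, c]) (b2 x)%:E)%E \is a fin_num.
  rewrite ge0_fin_numE; first exact: le_lt_trans (integral_unit_bump_le1 _ _) (ltry _).
  by apply: integral_ge0 => x _; rewrite lee_fin; case/andP: (unit_bump_ge0_le1 x).
have E : (c - a) * avg b2 a c = fine (\int[mu]_(x in `[a, c]) (b2 x)%:E)%E.
  by rewrite /avg mulrA divff// mul1r.
split.
- by rewrite E fineK.
- by rewrite E -lee_fin fineK// integral_unit_bump_le1.
- move=> a0; rewrite /avg /Rintegral integral_unit_bump (_ : _ `&` _ = set0).
    by rewrite measure0 mulr0.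
  rewrite -subset0 => x [] /=; rewrite !in_itv/=; lra.
Qed.

Lemma integral_unit_bump_avg (a c K : R) : a < c -> 0 <= K ->
  (\int[mu]_(x in `[a, c]) (K * (b2 x + avg b2 a c))%:E =
   (K * (2 * ((c - a) * avg b2 a c)))%:E)%E.
Proof.
move=> ac K0; have [I _ _] := avg_unit_bump ac.
have /andP[m0 _] := unit_bump_avg_ge0_le1 ac.
have mb2 : measurable_fun `[a, c] b2 by apply: measurable_indic; exact: measurable_itv.
under eq_integral do rewrite EFinM EFinD.
rewrite ge0_integralZl//=; last 2 first.
- apply: emeasurable_funD; last exact: measurable_cst.
  exact/measurable_EFinP.
- by move=> x _; rewrite -EFinD lee_fin addr_ge0//; case/andP: (unit_bump_ge0_le1 x).
rewrite ge0_integralD//=; last 2 first.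
- by move=> x _; rewrite lee_fin; case/andP: (unit_bump_ge0_le1 x).
- exact/measurable_EFinP.
rewrite I integral_cst//= lebesgue_measure_itv/= lte_fin ac -EFinB.
rewrite -[X in (_ + X)%E]EFinM -EFinD -EFinM.
by congr EFin; ring.
Qed.

(* The constant is scale free: [b1] has size at most [sqrt c] on [[a, c]] while
   [b2] has mass at most 1, and intervals on which neither function is constant
   contain 0, so that [c <= c - a]. *)
Lemma sqrt_unit_bump_joint_bound (a c : R) : a < c ->
  b1 c ^+ 2 * (2 * avg b2 a c) <= 2.
Proof.
move=> ac; have [_ m1 ma] := avg_unit_bump ac.
have /andP[m0 _] := unit_bump_avg_ge0_le1 ac.
have [c0|c0] := leP c 0.
  by rewrite ler0_sqrtr// expr0n/= mul0r.
have [a0|/ma ->] := leP a 0; last by rewrite mulr0 mulr0.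
(* With [m] the average, [c * m = (c - a) * m + a * m <= 1]. *)
have := mulr_le0_ge0 a0 m0.
by rewrite sqr_sqrtr; [nra|exact: ltW].
Qed.

(** The bound stays a square root of [b1 c ^+ 2], so that multiplying it by the bound for [b2]
    yields one root of the quantity in [sqrt_unit_bump_joint_bound]. *)
Lemma osc2_sqrt_le (a c : R) : a < c ->
  (osc2 b1 a c <= (b1 c ^+ 2)%:E `^ 2^-1)%E.
Proof.
move=> ac; have ca : 0 < c - a by rewrite subr_gt0.
have I0 : (0 <= \int[mu]_(x in `[a, c]) (`|b1 x - avg b1 a c| ^+ 2)%:E)%E.
  by apply: integral_ge0 => x _; rewrite lee_fin exprn_ge0.
apply: poweR_half_homo; first by rewrite mule_ge0// lee_fin invr_ge0 ltW.
rewrite muleC lee_pdivrMr//.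
have <- : mu `[a, c]%classic = (c - a)%:E.
  by rewrite lebesgue_measure_itv/= lte_fin ac -EFinB.
apply: nonneg_integral_le_cst; first exact: measurable_itv.
move=> x /=; rewrite in_itv/= => xac; rewrite !lee_fin exprn_ge0//=.
by rewrite lerXn2r ?nnegrE ?sqrtr_ge0// sqrt_avg_dist.
Qed.

Lemma osc2_unit_bump_le (a c : R) : a < c ->
  (osc2 b2 a c <= (2 * avg b2 a c)%:E `^ 2^-1)%E.
Proof.
move=> ac; have ca : 0 < c - a by rewrite subr_gt0.
have /andP[m0 _] := unit_bump_avg_ge0_le1 ac.
have I0 : (0 <= \int[mu]_(x in `[a, c]) (`|b2 x - avg b2 a c| ^+ 2)%:E)%E.
  by apply: integral_ge0 => x _; rewrite lee_fin exprn_ge0.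
apply: poweR_half_homo; first by rewrite mule_ge0// lee_fin invr_ge0 ltW.
rewrite muleC lee_pdivrMr// -EFinM.
have -> : 2 * avg b2 a c * (c - a) = 1 * (2 * ((c - a) * avg b2 a c)) by ring.
rewrite -integral_unit_bump_avg//; apply: nonneg_le_integral => x _.
  by rewrite lee_fin exprn_ge0.
by rewrite lee_fin mul1r unit_bump_avg_dist.
Qed.

Lemma S2_sqrt_unit_bump : (S2 b1 b2 <= 2%:E `^ 2^-1)%E.
Proof.
apply: ge_ereal_sup => _ [a [c [ac ->]]].
have /andP[m0 _] := unit_bump_avg_ge0_le1 ac.
have s0 : 0 <= b1 c ^+ 2 by rewrite exprn_ge0// sqrtr_ge0.
apply: le_trans (lee_pmul _ _ (osc2_sqrt_le ac) (osc2_unit_bump_le ac)) _.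
- exact: poweR_ge0.
- exact: poweR_ge0.
rewrite -poweRM; [|by rewrite lee_fin|by rewrite lee_fin mulr_ge0].
apply: poweR_half_homo; rewrite -EFinM lee_fin; first by rewrite mulr_ge0// mulr_ge0.
exact: sqrt_unit_bump_joint_bound.
Qed.

Lemma T2_sqrt_unit_bump : (T2 b1 b2 <= 2%:E `^ 2^-1)%E.
Proof.
apply: ge_ereal_sup => _ [a [c [ac ->]]].
have ca : 0 < c - a by rewrite subr_gt0.
have s0 : 0 <= b1 c ^+ 2 by rewrite exprn_ge0// sqrtr_ge0.
have I0 : (0 <= \int[mu]_(x in `[a, c])
    (`|b1 x - avg b1 a c| ^+ 2 * `|b2 x - avg b2 a c| ^+ 2)%:E)%E.
  by apply: integral_ge0 => x _; rewrite lee_fin mulr_ge0// exprn_ge0.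
apply: poweR_half_homo; first by rewrite mule_ge0// lee_fin invr_ge0 ltW.
rewrite muleC lee_pdivrMr//.
apply: (@le_trans _ _ (b1 c ^+ 2 * (2 * ((c - a) * avg b2 a c)))%:E); last first.
  rewrite -EFinM lee_fin.
  have -> : b1 c ^+ 2 * (2 * ((c - a) * avg b2 a c)) =
    b1 c ^+ 2 * (2 * avg b2 a c) * (c - a) by ring.
  by rewrite ler_pM2r// sqrt_unit_bump_joint_bound.
rewrite -integral_unit_bump_avg//; apply: nonneg_le_integral => x /= xac.
  by rewrite lee_fin mulr_ge0// exprn_ge0.
rewrite lee_fin ler_pM ?exprn_ge0 ?unit_bump_avg_dist//.
by rewrite lerXn2r ?nnegrE ?sqrtr_ge0// sqrt_avg_dist//; move: xac; rewrite in_itv.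
Qed.

(** * Divergence of the Luxemburg quantities on the intervals [[-u^2, u^2]] *)

(** On the nonpositive half [b1] vanishes, so the deviation is the mean itself. Since [b1 >= u / 2]
    on [[u^2 / 4, u^2]], which is 3/8 of the interval, the mean is at least [3 * u / 16]. *)
Lemma sqrt_avg_symmetric_ge (u x : R) : 1 <= u -> - u ^+ 2 <= x <= 0 ->
  u / 8 <= `|b1 x - avg b1 (- u ^+ 2) (u ^+ 2)|.
Proof.
move=> u1 /andP[_ x0]; rewrite ler0_sqrtr// sub0r normrN.
have u2 : 0 < u ^+ 2 by rewrite exprn_gt0//; lra.
apply: le_trans (ler_norm _).
have sqrtE y : 0 <= y -> b1 (y ^+ 2) = y by move=> ?; rewrite sqrtr_sqr ger0_norm.
have := @avg_ge R b1 (- u ^+ 2) (u ^+ 2) ((u / 2) ^+ 2) (u ^+ 2) (u / 2) u.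
have -> : u / 2 * (u ^+ 2 - (u / 2) ^+ 2) / (u ^+ 2 - - u ^+ 2) = u * (3 / 16).
  by field; rewrite gt_eqF//; lra.
move=> h; apply: le_trans (h _ _ _ _ _ _ _); [lra|lra|nra|nra|lra|lra| |].
- move=> y /andP[_ yu]; rewrite sqrtr_ge0/= -[leRHS]sqrtE; last lra.
  exact: ler_wsqrtr.
- by move=> y /andP[uy _]; rewrite -[leLHS]sqrtE; [exact: ler_wsqrtr|lra].
Qed.

(** The mean is at most [1 / (2 * u^2) <= 1 / 2], while [b2] equals 1 at [x]. *)
Lemma unit_bump_avg_symmetric_ge (u x : R) : 1 <= u -> -1 <= x <= 0 ->
  2^-1 <= `|b2 x - avg b2 (- u ^+ 2) (u ^+ 2)|.
Proof.
move=> u1 x10; rewrite unit_bump_in//.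
have u2 : 1 <= u ^+ 2 by rewrite exprn_ege1.
have ac : - u ^+ 2 < u ^+ 2 by lra.
have [_ m1 _] := avg_unit_bump ac; have /andP[m0 _] := unit_bump_avg_ge0_le1 ac.
apply: le_trans (ler_norm _); nra.
Qed.

(** This is the last hypothesis of [lux_ge] for a spike of height proportional to [u] on [[-1, 0]]:
    [2 * u^2] is the length of [[-u^2, u^2]] and the spike has width 1. Growth with constant
    [3 / k^2] gives [A (k * u) >= 3 * u^2]. *)
Lemma B2_conj_spike (A : R -> R) (k : R) : young A -> B2 (young_conj A) ->
  0 < k -> exists2 u, 1 <= u & 2 * u ^+ 2 < A (k * u).
Proof.
move=> yA BA k0; have k2 : 0 < k ^+ 2 by rewrite exprn_gt0.
have [|T T0 AT] := B2_conj_quadratic_growth yA BA (M := 3 / k ^+ 2).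
  by rewrite divr_gt0.
have Tk : 0 < T / k by rewrite divr_gt0.
exists (1 + T / k); first lra.
apply: lt_le_trans (AT _ _); last first.
  by rewrite mulrDr mulr1 [k * (T / k)]mulrC divfK ?gt_eqF//; lra.
set u := 1 + T / k; have u2 : 0 < u ^+ 2 by rewrite exprn_gt0// /u; lra.
have -> : 3 / k ^+ 2 * (k * u) ^+ 2 = 3 * u ^+ 2 by field; rewrite gt_eqF.
lra.
Qed.

Lemma SAB_sqrt_unit_bump (A B : R -> R) : young A -> young B ->
  B2 (young_conj B) -> SAB A B b1 b2 = +oo%E.
Proof.
move=> yA yB BB; apply/eqyP => r r0.
have [t t0 At] := young_unbounded 2 yA.
have [|u u1 Bu] := B2_conj_spike yB BB (k := (16 * t * r)^-1).
  by rewrite invr_gt0 !mulr_gt0.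
have u0 : 0 < u by lra.
have u2 : 1 <= u ^+ 2 by rewrite exprn_ege1.
have ac : - u ^+ 2 < u ^+ 2 by lra.
(* The thresholds satisfy [K1 * K2 = r]. The deviation [u / 8] of [b1] is [t * K1], and [A t > 2]
   compensates for its being used on only half the interval; the deviation [1 / 2] of [b2] is
   [k * u * K2] with [k = (16 * t * r)^-1]. *)
pose K1 := u / (8 * t); pose K2 := 8 * t * r / u.
have K10 : 0 < K1 by rewrite divr_gt0// mulr_gt0.
have K20 : 0 < K2 by rewrite divr_gt0// !mulr_gt0.
apply: (@le_trans _ _ (K1%:E * K2%:E)%E).
  rewrite -EFinM lee_fin le_eqVlt; apply/orP; left; apply/eqP.
  by rewrite /K1 /K2; field; rewrite !gt_eqF.
apply: le_trans (ereal_sup_ubound _); last by exists (- u ^+ 2), (u ^+ 2); split.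
apply: lee_pmul; [by rewrite lee_fin ltW|by rewrite lee_fin ltW| |].
- apply: (@lux_ge _ _ _ _ _ (- u ^+ 2) 0 (u / 8)) => //; try lra.
    by move=> x; exact: sqrt_avg_symmetric_ge.
  have -> : u / 8 / K1 = t by rewrite /K1; field; rewrite !gt_eqF.
  by nra.
- apply: (@lux_ge _ _ _ _ _ (-1) 0 2^-1) => //; try lra.
    by move=> x; exact: unit_bump_avg_symmetric_ge.
  have -> : 2^-1 / K2 = (16 * t * r)^-1 * u.
    by rewrite /K2; field; rewrite !gt_eqF.
  lra.
Qed.

Lemma TC_sqrt_unit_bump (C : R -> R) : young C -> B2 (young_conj C) ->
  TC C b1 b2 = +oo%E.
Proof.
move=> yC BC; apply/eqyP => r r0.
(* On [[-1, 0]] the product of the deviations is at least [u / 16], which is [k * u] times the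
   target [r]. *)
have [|u u1 Cu] := B2_conj_spike yC BC (k := (16 * r)^-1).
  by rewrite invr_gt0 mulr_gt0.
have u2 : 1 <= u ^+ 2 by rewrite exprn_ege1.
apply: le_trans (ereal_sup_ubound _); last by exists (- u ^+ 2), (u ^+ 2); split => //; lra.
apply: (@lux_ge _ _ _ _ _ (-1) 0 (u / 8 * 2^-1)) => //; try lra.
- move=> x x10; apply: ler_pM; [lra|lra| |exact: unit_bump_avg_symmetric_ge].
  by apply: sqrt_avg_symmetric_ge => //; lra.
- have -> : u / 8 * 2^-1 / r = (16 * r)^-1 * u by field; rewrite gt_eqF.
  lra.
Qed.

(** * The Hilbert transform of the bump and the unbounded commutator *)

Lemma hilbert0 (x : R) : hilbert (fun=> 0) x = 0.
Proof.
rewrite /hilbert; apply: lim_near_cst => //; near=> eps.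
by under eq_Rintegral do rewrite mul0r; rewrite /Rintegral integral0.
Unshelve. all: by end_near. Qed.

(** For [y] in [[-1, 0]] the distance to [x] is at least [x], so truncation at [eps < x] removes
    nothing from the support and the limit is that of an eventually constant function. *)
Lemma hilbert_unit_bump (x : R) : 0 < x ->
  hilbert b2 x = \int[mu]_(y in `[-1, 0]) (x - y)^-1.
Proof.
move=> x0; rewrite /hilbert; apply: lim_near_cst => //; near=> eps.
rewrite Rintegral_mkcond [RHS]Rintegral_mkcond; apply: eq_Rintegral => y _.
rewrite !patchE; case: ifPn => [_|].
  case: ifPn => [/set_mem|]; rewrite /= ?in_itv/=.
    by move=> y10; rewrite unit_bump_in// mul1r.
  rewrite notin_setE/= in_itv/= => /negP y10.
  by rewrite unit_bump_out// mul0r.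
rewrite notin_setE/= => /negP; rewrite -leNgt => xye.
have xe : eps < x by near: eps; exact: nbhs_right_lt.
rewrite memNset//= in_itv/= => /andP[_ y0].
by have := ler_norm (x - y); lra.
Unshelve. all: by end_near. Qed.

Lemma hilbert_unit_bump_ge (x : R) : 0 < x -> (1 + x)^-1 <= hilbert b2 x.
Proof.
move=> x0; rewrite hilbert_unit_bump// /Rintegral.
have mu1 : mu `[-1, 0]%classic = 1%E.
  by rewrite lebesgue_measure_itv/= lte_fin ltrN10 -EFinB sub0r opprK.
have pos y : `[-1, 0]%classic y -> (0 <= ((x - y)^-1)%:E)%E.
  by rewrite /= in_itv/= lee_fin invr_ge0; lra.
rewrite -lee_fin fineK.
  rewrite -[leLHS]mule1 -mu1; apply: nonneg_integral_ge_cst => //.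
    by rewrite invr_ge0; lra.
  by move=> y; rewrite /= in_itv/= => y10; rewrite lee_fin lef_pV2 ?posrE; lra.
(* The integrand is at most [x^-1] on an interval of length 1, so the integral is finite and [fine]
   returns its true value. *)
rewrite ge0_fin_numE; last exact: integral_ge0.
apply: le_lt_trans (ltry x^-1).
rewrite -[leRHS]mule1 -mu1; apply: nonneg_integral_le_cst; first exact: measurable_itv.
move=> y y10; rewrite pos//= lee_fin lef_pV2 ?posrE//;
  by move: y10; rewrite /= in_itv/=; lra.
Qed.

(** Three of the four terms vanish: [b2 x = 0] removes the two led by [b2], and [b1 * b2 = 0]
    removes one more. The survivor simplifies by [b2 * b2 = b2]. *)
Lemma CbH_unit_bump (x : R) : 0 < x -> CbH b1 b2 b2 x = - (b1 x * hilbert b2 x).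
Proof.
move=> x0; rewrite /CbH {1}/commut unit_bump_out ?mul0r ?sub0r; last lra.
have -> : (fun y => b2 y * b2 y) = b2.
  apply/funext => y; have [h|h] := boolP (-1 <= y <= 0).
    by rewrite unit_bump_in// mulr1.
  by rewrite unit_bump_out// mulr0.
rewrite /commut; have -> : (fun y => b1 y * b2 y) = fun=> 0.
  apply/funext => y; have [h|h] := boolP (-1 <= y <= 0).
    by rewrite ler0_sqrtr ?mul0r//; lra.
  by rewrite unit_bump_out// mulr0.
by rewrite hilbert0 subr0.
Qed.

Lemma L2norm_CbH_unit_bump : L2norm (CbH b1 b2 b2) = +oo%E.
Proof.
rewrite /L2norm unlock; apply: eqy_poweR; first by rewrite invr_gt0.
apply/eqP; rewrite -leye_eq.
pose g x := (`|(EFin \o CbH b1 b2 b2) x| `^ 2)%E.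
rewrite -(@integral_windows_pinfty R g 1 8^-1)//.
- rewrite [leLHS]integral_mkcond; apply: nonneg_le_integral => x _; rewrite patchE.
    by case: ifP => // _; exact: poweR_ge0.
  by case: ifP => // _; exact: poweR_ge0.
- by move=> x _; exact: poweR_ge0.
(* For [1 <= x < 2 * T], [x / (1 + x)^2 >= 1 / (4 * x) >= 1 / (8 * T)]: each dyadic window
   contributes 1/8, a logarithmic divergence. *)
move=> T T1; exists T, (2 * T), (8 * T)^-1; split => //; [lra| | |].
- by rewrite invr_ge0; lra.
- rewrite (_ : _ * _ = 8^-1) //; field.
  by rewrite gt_eqF//; lra.
move=> x /andP[Tx xT]; have x0 : 0 < x by lra.
rewrite /g/= lee_fin CbH_unit_bump// normrN powR_mulrn//.
rewrite real_normK ?num_real//.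
have hx : (1 + x)^-1 <= hilbert b2 x by exact: hilbert_unit_bump_ge.
rewrite exprMn sqr_sqrtr; last exact: ltW.
apply: (@le_trans _ _ (x * ((1 + x)^-1) ^+ 2)); last first.
  rewrite ler_pM2l// lerXn2r// nnegrE; first by rewrite invr_ge0; lra.
  by apply: le_trans hx; rewrite invr_ge0; lra.
rewrite exprVn ler_pdivlMr ?exprn_gt0//; last lra.
rewrite mulrC ler_pdivrMr; last lra.
nra.
Qed.

Lemma L2norm_unit_bump_lty : (L2norm b2 < +oo)%E.
Proof.
rewrite /L2norm unlock; apply: poweR_lty.
rewrite [ltLHS](_ : _ = \int[mu]_x (b2 x)%:E)%E; last first.
  apply: eq_integral => x _ /=; have [h|h] := boolP (-1 <= x <= 0).
    by rewrite unit_bump_in// normr1 powR1.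
  by rewrite unit_bump_out// normr0 powR0.
by rewrite integral_indic//= setIT lebesgue_measure_itv/= lte_fin ltrN10 -EFinB ltry.
Qed.

Lemma CbH_unbounded : ~ L2_bounded (CbH b1 b2).
Proof.
move=> [M /(_ b2)]; rewrite L2norm_CbH_unit_bump leye_eq => h.
suff : (M%:E * L2norm b2 < +oo)%E.
  rewrite lt_neqAle => /andP[/negP + _]; apply; apply: h; split.
  - by have [] := Linfty_loc_unit_bump.
  - by exists 1 => x; have /andP[? ?] := unit_bump_ge0_le1 x; rewrite ger0_norm.
  - by exists (-1), 0 => x /negP; exact: unit_bump_out.
have := L2norm_unit_bump_lty; have : (0 <= L2norm b2)%E by exact: Lnorm_ge0.
by case: (L2norm b2) => [r| |]//= _ _; rewrite -EFinM ltry.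
Qed.

End example.

Theorem theorem4p5 (R : realType) :
  exists b1 b2 : R -> R,
    [/\ Linfty_loc b1, Linfty_loc b2,
        (S2 b1 b2 + T2 b1 b2 < +oo)%E,
        (forall A B C : R -> R, young A -> young B -> young C ->
           B2 (young_conj A) -> B2 (young_conj B) -> B2 (young_conj C) ->
           SAB A B b1 b2 = +oo%E /\ TC C b1 b2 = +oo%E) &
        ~ L2_bounded (CbH b1 b2)].
Proof.
exists Num.sqrt, unit_bump; split.
- exact: Linfty_loc_sqrt.
- exact: Linfty_loc_unit_bump.
- apply: (le_lt_trans (leeD S2_sqrt_unit_bump T2_sqrt_unit_bump)).
  by rewrite poweR_EFin -EFinD ltry.
- move=> A B C yA yB yC _ BB BC; split; first exact: SAB_sqrt_unit_bump.
  exact: TC_sqrt_unit_bump.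
- exact: CbH_unbounded.
Qed.
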